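(* There exists a finite-dimensional vector space $V$ with a finite scalar field of characteristic $3$ such that the inequality \begin{align*} H(A) \le\ & 8H(Z) + 29H(Y) + 3H(X) + 8H(W) - 6H(D) - 17H(C) - 8H(B) - 17H(A)\\ & + 55H(Z|A,B,C) + 35H(Y|W,X,Z) + 50H(X|A,C,D) + 49H(W|B,C,D)\\ & + 18H(A|B,D,Y) + 7H(B|D,X,Z) + H(B|A,W,X) + 7H(C|D,Y,Z)\\ & + 7H(C|B,X,Y) + 3H(C|A,W,Y) + 6H(D|A,W,Z)\\ & + 49\bigl(H(A) + H(B) + H(C) + H(D) - H(A,B,C,D)\bigr) \end{align*} is not a linear rank inequality over $V$; that is, there are subspaces $A,B,C,D,W,X,Y,Z$ of $V$ for which the inequality fails.
   Context: For subspaces of a finite-dimensional vector space $V$, $H(S)$ denotes the dimension (rank) of the subspace $S$; $H(S_1,\dots,S_m)$ denotes the dimension of the span of $S_1\cup\dots\cup S_m$; and $H(S|T_1,\dots,T_m) = H(S,T_1,\dots,T_m) - H(T_1,\dots,T_m)$. A linear rank inequality over $V$ is a linear inequality among such quantities that is satisfied by every assignment of subspaces of $V$ to the variables. *)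

(* Defs.v *)
From HB Require Import structures.
From mathcomp Require Import all_boot all_order all_algebra.
Set Implicit Arguments.
Unset Strict Implicit.
Unset Printing Implicit Defensive.
Import GRing.Theory Num.Theory.
Local Open Scope ring_scope.

(* Formal linear expressions in the ranks of subspaces named by elements of I.
   Having them as syntax makes "linear inequality" a notion independent of the
   vector space in which the variables are then interpreted. *)
Inductive rank_expr (I : Type) : Type :=
| Rank of seq I
| CondRank of I & seq I
| Scale of int & rank_expr I
| Add of rank_expr I & rank_expr I
| Sub of rank_expr I & rank_expr I.

Inductive rank_inequality (I : Type) : Type :=
| RankLe of rank_expr I & rank_expr I.

Declare Scope rank_scope.
Delimit Scope rank_scope with rank.
Bind Scope rank_scope with rank_expr.
Bind Scope rank_scope with rank_inequality.
Arguments Scale {I} _%_Z _%_rank.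

Notation "''H' ( x , .. , y )" := (Rank (cons x .. (cons y nil) ..))
  (at level 0, x at level 99, y at level 99,
   format "''H' ( x ,  .. ,  y )") : rank_scope.
Notation "''H' ( s | x , .. , y )" := (CondRank s (cons x .. (cons y nil) ..))
  (at level 0, s at level 99, x at level 99, y at level 99,
   format "''H' ( s  |  x ,  .. ,  y )") : rank_scope.
Notation "k * e" := (Scale k e) : rank_scope.
Notation "e + f" := (Add e f) : rank_scope.
Notation "e - f" := (Sub e f) : rank_scope.
Notation "e <= f" := (RankLe e f) : rank_scope.

Section Semantics.
Variables (F : fieldType) (V : vectType F) (I : Type).
Implicit Types (S : I -> {vspace V}) (e : rank_expr I).

Definition rank S (s : seq I) : int := (\dim (\sum_(i <- s) S i)%VS)%:Z.

(* int, not nat, so that subtraction is not truncated *)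
Fixpoint rank_eval S e : int :=
  match e with
  | Rank s => rank S s
  | CondRank i t => rank S (i :: t) - rank S t
  | Scale k e1 => k * rank_eval S e1
  | Add e1 e2 => rank_eval S e1 + rank_eval S e2
  | Sub e1 e2 => rank_eval S e1 - rank_eval S e2
  end.

Definition satisfies S (q : rank_inequality I) : Prop :=
  let: RankLe e f := q in rank_eval S e <= rank_eval S f.

End Semantics.

Definition linear_rank_inequality (F : fieldType) (V : vectType F) (I : Type)
    (q : rank_inequality I) : Prop :=
  forall S : I -> {vspace V}, satisfies S q.
Arguments linear_rank_inequality {F} V {I} q%_rank.

Inductive var : Type := A | B | C | D | W | X | Y | Z.

(* Main.v *)
(* Over a field of characteristic 3 take the lines spanned by the unit vectors
   A, B, C, D of F^4 and by W = B + C + D, X = A + C + D, Y = A + B + D,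
   Z = A + B + C (a representation of the matroid T8).  Then
   W + X + Y + Z = 3 (A + B + C + D) = 0, so every conditional rank in the
   inequality vanishes; A, B, C, D are independent, the coefficients of the
   remaining ranks on the right add up to 0, and the inequality reads 1 <= 0. *)

Require Import Defs.
From HB Require Import structures.
From mathcomp Require Import all_boot all_order all_algebra.
Set Implicit Arguments.
Unset Strict Implicit.
Unset Printing Implicit Defensive.
Import GRing.Theory.
Local Open Scope ring_scope.

Lemma rank_line (F : fieldType) (V : vectType F) (I : Type) (v : I -> V) (i : I) :
  v i != 0 -> rank_eval (fun i => <[v i]>%VS) ('H(i))%rank = 1.
Proof. by move=> vi_neq0; rewrite /= /rank big_seq1 dim_vline vi_neq0. Qed.

(** The line of [v x] already lies in the sum of the other three, so adding it leaves the dimension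
    unchanged. Explicit coefficients reduce each use to a check of coordinates. *)
Lemma condrank_lines_eq0 (F : fieldType) (V : vectType F) (I : Type)
    (v : I -> V) (a b c : F) (x i j k : I) :
  v x = a *: v i + b *: v j + c *: v k ->
  rank_eval (fun i => <[v i]>%VS) ('H(x | i, j, k))%rank = 0.
Proof.
move=> vx; apply/eqP; rewrite /= /rank big_cons subr_eq0; apply/eqP.
congr (Posz (\dim _)); apply/addv_idPr.
rewrite !big_cons big_nil addv0 addvA -memvE vx.
by rewrite !memv_add ?memvZ ?memv_line.
Qed.

Lemma rank_basis (F : fieldType) (V : vectType F) (I : Type)
    (v : I -> V) (s : seq I) :
  basis_of fullv (map v s) -> rank (fun i => <[v i]>%VS) s = (\dim {:V})%:Z.
Proof. by move=> /span_basis <-; rewrite span_def big_map. Qed.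

Definition T8 (x : var) : 'rV['F_3]_4 :=
  \row_(j < 4) nth 0 (match x with
    | A => [:: 1; 0; 0; 0] | B => [:: 0; 1; 0; 0]
    | C => [:: 0; 0; 1; 0] | D => [:: 0; 0; 0; 1]
    | W => [:: 0; 1; 1; 1] | X => [:: 1; 0; 1; 1]
    | Y => [:: 1; 1; 0; 1] | Z => [:: 1; 1; 1; 0]
    end) j.

Lemma T8_neq0 (x : var) : T8 x != 0.
Proof.
apply/eqP => /rowP T8x0.
by case: x T8x0 => T8x0;
  (* Each branch picks a column where the vector has entry 1. *)
  [ have := T8x0 0 | have := T8x0 1 | have := T8x0 2%:R | have := T8x0 3%:R
  | have := T8x0 1 | have := T8x0 0 | have := T8x0 0 | have := T8x0 0 ];
  rewrite !mxE.
Qed.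

Lemma T8_basis : basis_of fullv (map T8 [:: A; B; C; D]).
Proof.
(* Four vectors in dimension 4: spanning suffices, and freeness follows. *)
rewrite basisEdim size_map dimvf /dim /= andbT.
apply/subvP => u _.
have -> : u = u 0 0 *: T8 A + (u 0 1 *: T8 B + (u 0 2%:R *: T8 C + u 0 3%:R *: T8 D)).
  apply/rowP => -[[|[|[|[|//]]]] lt_j4]; rewrite !mxE /=
    ?mulr1 ?mulr0 ?addr0 ?add0r; congr (u _ _); exact/val_inj.
by rewrite !memvD // memvZ // memv_span // !inE eqxx ?orbT.
Qed.

Theorem theorem3p2 :
  exists (F : finFieldType) (V : vectType F),
    3%N \in [pchar F] /\
    ~ linear_rank_inequality V
        ('H(A) <=
           8 * 'H(Z) + 29 * 'H(Y) + 3 * 'H(X) + 8 * 'H(W)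
         - 6 * 'H(D) - 17 * 'H(C) - 8 * 'H(B) - 17 * 'H(A)
         + 55 * 'H(Z | A, B, C) + 35 * 'H(Y | W, X, Z)
         + 50 * 'H(X | A, C, D) + 49 * 'H(W | B, C, D)
         + 18 * 'H(A | B, D, Y) + 7 * 'H(B | D, X, Z)
         + 'H(B | A, W, X) + 7 * 'H(C | D, Y, Z)
         + 7 * 'H(C | B, X, Y) + 3 * 'H(C | A, W, Y)
         + 6 * 'H(D | A, W, Z)
         + 49 * ('H(A) + 'H(B) + 'H(C) + 'H(D) - 'H(A, B, C, D))).
Proof.
exists 'F_3, 'rV['F_3]_4; split; first exact: pchar_Fp.
move=> /(_ (fun x => <[T8 x]>%VS)) /=.
have line x : rank (fun x => <[T8 x]>%VS) [:: x] = 1 by exact/rank_line/T8_neq0.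
(* The conditional ranks are already unfolded to differences by [/=], hence this form for
   rewriting. *)
have dep (a b c : 'F_3) x i j k : T8 x = a *: T8 i + b *: T8 j + c *: T8 k ->
    rank (fun x => <[T8 x]>%VS) [:: x; i; j; k]
      - rank (fun x => <[T8 x]>%VS) [:: i; j; k] = 0.
  exact: condrank_lines_eq0.
rewrite !line (rank_basis T8_basis) dimvf.
rewrite (dep 1 1 1 Z A B C); last first.
  by apply/rowP => -[[|[|[|[|//]]]] ?]; rewrite !mxE; apply/val_inj.
(* Of the eleven relations only this one depends on characteristic 3: over the integers,
   [- W - X - Z] has coordinates (-2, -2, -3, -2), which reduce to those of [Y] modulo 3. *)
rewrite (dep (-1) (-1) (-1) Y W X Z); last first.
  by apply/rowP => -[[|[|[|[|//]]]] ?]; rewrite !mxE; apply/val_inj.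
rewrite (dep 1 1 1 X A C D); last first.
  by apply/rowP => -[[|[|[|[|//]]]] ?]; rewrite !mxE; apply/val_inj.
rewrite (dep 1 1 1 W B C D); last first.
  by apply/rowP => -[[|[|[|[|//]]]] ?]; rewrite !mxE; apply/val_inj.
rewrite (dep (-1) (-1) 1 A B D Y); last first.
  by apply/rowP => -[[|[|[|[|//]]]] ?]; rewrite !mxE; apply/val_inj.
(* From here on, a difference of two of [W], [X], [Y], [Z] is a difference of two unit vectors, here
   [Z - X = B - D]. *)
rewrite (dep 1 (-1) 1 B D X Z); last first.
  by apply/rowP => -[[|[|[|[|//]]]] ?]; rewrite !mxE; apply/val_inj.
rewrite (dep 1 1 (-1) B A W X); last first.
  by apply/rowP => -[[|[|[|[|//]]]] ?]; rewrite !mxE; apply/val_inj.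
rewrite (dep 1 (-1) 1 C D Y Z); last first.
  by apply/rowP => -[[|[|[|[|//]]]] ?]; rewrite !mxE; apply/val_inj.
rewrite (dep 1 1 (-1) C B X Y); last first.
  by apply/rowP => -[[|[|[|[|//]]]] ?]; rewrite !mxE; apply/val_inj.
rewrite (dep 1 1 (-1) C A W Y); last first.
  by apply/rowP => -[[|[|[|[|//]]]] ?]; rewrite !mxE; apply/val_inj.
rewrite (dep 1 1 (-1) D A W Z); last first.
  by apply/rowP => -[[|[|[|[|//]]]] ?]; rewrite !mxE; apply/val_inj.
(* What is left is [1 <= 48 - 48 + 49 * (4 - 4)], false by computation. *)
by [].
Qed.
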